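(* For every integer $n \ge 15$, the doubly metric dimension of the Kneser graph $K_{n,2}$ is $\psi(K_{n,2}) = \lceil 2n/3 \rceil$.
   Context: The Kneser graph $K_{n,2}$ has as vertices all $2$-element subsets of $[n]=\{1,\dots,n\}$, two being adjacent iff they are disjoint; $d$ denotes shortest-path distance. Vertices $x,y$ doubly resolve vertices $u,v$ if $d(u,x)-d(u,y)\ne d(v,x)-d(v,y)$. A vertex set $D$ is a doubly resolving set if every two distinct vertices are doubly resolved by some two vertices of $D$; $\psi(G)$ is the minimum cardinality of a doubly resolving set of $G$. *)

(* Defs.v *)
From mathcomp Require Import all_boot all_order all_algebra.

Set Implicit Arguments.
Unset Strict Implicit.
Unset Printing Implicit Defensive.

Import Order.TTheory GRing.Theory Num.Theory.

Section GraphDistance.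
Variables (T : finType) (e : rel T).

Definition walk (k : nat) (x y : T) : bool :=
  [exists p : k.-tuple T, path e x p && (last x p == y)].

(* A shortest path has length < #|T|, so searching k = 0, ..., #|T| - 1       *)
(* suffices; the junk value for unconnected x and y is #|T|.                  *)
Definition dist (x y : T) : nat := find (fun k => walk k x y) (iota 0 #|T|).

Definition doubly_resolves (x y u v : T) : bool :=
  ((dist u x)%:Z - (dist u y)%:Z != (dist v x)%:Z - (dist v y)%:Z)%R.

Definition doubly_resolving (D : {set T}) : bool :=
  [forall u, forall v, (u != v) ==>
     [exists x in D, exists y in D, doubly_resolves x y u v]].

(* The arg min is only meaningful if setT is doubly resolving, which holds    *)
(* for every undirected graph: see doubly_resolvingT.                         *)
Definition psi : nat :=
  #|[arg min_(D < [set: T] | doubly_resolving D) #|D| ]|.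

Lemma walkP k x y :
  reflect (exists p : seq T, [/\ size p = k, path e x p & last x p = y])
          (walk k x y).
Proof.
apply: (iffP existsP) => [[p /andP[ep /eqP ly]]|[p [sp ep ly]]].
  by exists p; rewrite size_tuple.
by exists (tcast sp (in_tuple p)); rewrite val_tcast /= ep ly eqxx.
Qed.

Lemma dist_min x y k : walk k x y -> dist x y <= k.
Proof.
move=> wk; rewrite /dist; case: (ltnP k #|T|) => [lt|].
  rewrite leqNgt; apply/negP => /(before_find 0).
  by rewrite nth_iota // add0n wk.
by apply: leq_trans; rewrite -[leqRHS](size_iota 0); exact: find_size.
Qed.

Lemma dist_walk x y : connect e x y -> walk (dist x y) x y.
Proof.
move/connectP => [p ep ->]; case/shortenP: ep => q eq uq _.
have lt : size q < #|T| by have := max_card (mem (x :: q)); rewrite (card_uniqP uq).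
have H : has (fun k => walk k x (last x q)) (iota 0 #|T|).
  apply/hasP; exists (size q); first by rewrite mem_iota.
  by apply/walkP; exists q.
have := nth_find 0 H; rewrite nth_iota ?add0n //.
by move: H; rewrite has_find size_iota.
Qed.

Lemma dist_eq0 x y : (dist x y == 0) = (x == y).
Proof.
have T0 : 0 < #|T| by apply/card_gt0P; exists x.
have w0 : walk 0 x y = (x == y).
  apply/walkP/eqP => [[p [/size0nil-> _ //]]|->]; by exists [::].
rewrite /dist; case: #|T| T0 => // n _ /=; rewrite w0.
by case: (x == y).
Qed.

Hypothesis e_sym : symmetric e.

Lemma walk_sym k x y : walk k x y -> walk k y x.
Proof.
move=> /walkP[p [sp ep ly]]; apply/walkP.
exists (rev (belast x p)); split; first by rewrite size_rev size_belast.
  by rewrite -ly rev_path; apply: sub_path ep => a b; rewrite /= e_sym.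
by case: p ly {sp ep} => [<-|a p _] //=; rewrite rev_cons last_rcons.
Qed.

Lemma dist_sym x y : dist x y = dist y x.
Proof. by apply: eq_find => k; apply/idP/idP; apply: walk_sym. Qed.

Lemma doubly_resolvingT : doubly_resolving [set: T].
Proof.
apply/forallP => u; apply/forallP => v; apply/implyP => uv.
apply/existsP; exists u; rewrite inE /=; apply/existsP; exists v; rewrite inE /=.
have /eqP d0 : dist u u == 0 by rewrite dist_eq0.
have /eqP d1 : dist v v == 0 by rewrite dist_eq0.
rewrite /doubly_resolves d0 d1 (dist_sym v u) sub0r subr0.
rewrite eq_sym -subr_eq0 opprK -PoszD eqz_nat addn_eq0 andbb dist_eq0.
exact: uv.
Qed.

Lemma psiP :
  (exists2 D : {set T}, doubly_resolving D & #|D| = psi) /\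
  (forall D : {set T}, doubly_resolving D -> psi <= #|D|).
Proof.
rewrite /psi; case: arg_minnP => [|D rD minD]; first exact: doubly_resolvingT.
by split=> //; exists D.
Qed.

End GraphDistance.

Definition kneser_vertex (n k : nat) : finType := {A : {set 'I_n} | #|A| == k}.

Definition kneser (n k : nat) : rel (kneser_vertex n k) :=
  fun A B => [disjoint val A & val B].

Lemma kneser_sym n k : symmetric (@kneser n k).
Proof. by move=> A B; rewrite /kneser disjoint_sym. Qed.

(* Main.v *)
Require Import Defs.
From mathcomp Require Import all_boot all_order all_algebra.
From mathcomp Require Import zify lra.

(**
In K_{n,2} with n >= 5, d(u, x) is an injective function of |u :&: x|
(0 -> 1, 1 -> 2, 2 -> 0). View D as the edge set of a graph on [n].

Lower bound. D must tell u and v apart through the intersection sizes |u :&: x|,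
so no two vertices of [n] lie on the same edges of D: at most one vertex is
isolated and no component is a single edge. Discharging from edges to endpoints
then gives 3|D| >= 2n if no vertex is isolated. If a is isolated, a component
b - c - d is also impossible ({a, c} versus {b, d}), and discharging gives
4|D| >= 3(n - 1).

Upper bound. Take k = n %/ 3 disjoint stars with at least two leaves each. As
k >= 5, some star misses u and v, so the difference d(u, x) - d(v, x) can only be
the constant 0; it then remains to recover u from the numbers |u :&: x|.
*)

Set Implicit Arguments.
Unset Strict Implicit.
Unset Printing Implicit Defensive.

Lemma card_set2I (V : finType) (a b : V) (x : {set V}) :
  a != b -> #|[set a; b] :&: x| = (a \in x) + (b \in x).
Proof.
move=> ab; rewrite -sum1_card (eq_bigl (fun i => (i \in [set a; b]) && (i \in x))).
  rewrite big_mkcondr big_setU1 ?inE //= big_set1.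
  by case: (a \in x); case: (b \in x).
by move=> i; rewrite inE.
Qed.

(** * Lower bound: discharging on a separating set of edges *)

Section Discharging.
Variables (V : finType) (E : {set {set V}}).
Hypothesis E2 : forall x, x \in E -> #|x| = 2.

Definition incident (v : V) := [set x in E | v \in x].

Definition degree (v : V) := #|incident v|.

(** The share of [v] in the weight [m.*2] of its edge [x]: leaf and support vertex split it as [b]
    and [s], two non-leaves halve it. *)
Definition charge (b m s : nat) (v : V) (x : {set V}) : nat :=
  if degree v == 1 then b
  else if [exists w in x, degree w == 1] then s else m.

(** Swap the sums: an edge with at most one leaf pays [b + s] or [m + m]. *)
Lemma sum_charge b m s : b + s = m.*2 ->
  (forall x, x \in E -> exists2 v, v \in x & degree v != 1) ->
  \sum_v \sum_(x in incident v) charge b m s v x = m.*2 * #|E|.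
Proof.
move=> bs nl; rewrite (exchange_big_dep (mem E)) //=; last first.
  by move=> v x _; rewrite inE => /andP[].
rewrite mulnC -sum_nat_const; apply: eq_bigr => x xE.
rewrite (eq_bigl (fun v => v \in x)); last by move=> v; rewrite inE xE.
have /eqP/cards2P[p [q [pq xpq]]] := E2 xE.
rewrite xpq big_setU1 ?inE //= big_set1 /charge.
have -> : [exists w in [set p; q], degree w == 1] = (degree p == 1) || (degree q == 1).
  apply/existsP/orP => [[w]|].
    by rewrite !inE => /andP[/orP[]/eqP-> ->]; [left|right].
  by case=> h; [exists p|exists q]; rewrite !inE eqxx ?orbT.
have [v] := nl x xE; rewrite xpq !inE => /orP[]/eqP-> /negPf->.
  by rewrite /=; case: (degree q == 1); rewrite ?addnn // addnC.
by rewrite orbF /=; case: (degree p == 1); rewrite ?addnn.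
Qed.

Hypothesis sep : forall u v : {set V}, #|u| = 2 -> #|v| = 2 ->
  (forall x, x \in E -> #|u :&: x| = #|v :&: x|) -> u = v.
Hypothesis V9 : 9 <= #|V|.

(** For any third vertex [c], the pairs {a, c} and {b, c} would meet every edge equally. *)
Lemma no_twins (a b : V) : (forall x, x \in E -> (a \in x) = (b \in x)) -> a = b.
Proof.
move=> tw; apply/eqP/negPn/negP => ab.
have [c] : exists c, c \in ~: [set a; b].
  by apply/card_gt0P; have := cardsC [set a; b]; rewrite cards2 ab; lia.
rewrite !inE negb_or => /andP[ca cb].
have ac : a != c by rewrite eq_sym.
have bc : b != c by rewrite eq_sym.
have : a \in [set b; c].
  rewrite -(@sep [set a; c] [set b; c]) ?cards2 ?ac ?bc ?inE ?eqxx // => x xE.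
  by rewrite !card_set2I // tw.
by rewrite !inE (negPf ab) (negPf ac).
Qed.

Lemma leaf_edge v x y : degree v = 1 -> x \in E -> y \in E ->
  v \in x -> v \in y -> x = y.
Proof.
rewrite /degree => /eqP/cards1P[z Ez] xE yE vx vy.
have : x \in incident v by rewrite inE xE.
have : y \in incident v by rewrite inE yE.
by rewrite Ez !inE => /eqP-> /eqP->.
Qed.

Lemma isolated_notin v x : degree v = 0 -> x \in E -> v \notin x.
Proof.
move=> /eqP; rewrite cards_eq0 => /eqP/setP/(_ x); rewrite !inE => h xE.
by move: h; rewrite xE /= => ->.
Qed.

(** Two adjacent leaves would be twins. *)
Lemma edge_has_nonleaf x : x \in E -> exists2 v, v \in x & degree v != 1.
Proof.
move=> xE; have /eqP/cards2P[p [q [pq xpq]]] := E2 xE.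
have px : p \in x by rewrite xpq !inE eqxx.
have qx : q \in x by rewrite xpq !inE eqxx orbT.
have [p1|] := eqVneq (degree p) 1; last by exists p.
have [q1|] := eqVneq (degree q) 1; last by exists q.
case/eqP: pq; apply: no_twins => y yE; apply/idP/idP => h.
  by rewrite (leaf_edge p1 yE xE h px).
by rewrite (leaf_edge q1 yE xE h qx).
Qed.

(** With leaves [b] in [x] and [d] in [y], both {a, c} and {b, d} meet [x] and [y] once and no other
    edge. *)
Lemma isolated_no_P3 a c x y : degree a = 0 -> x \in E -> y \in E -> x != y ->
  incident c = [set x; y] ->
  [exists w in x, degree w == 1] -> [exists w in y, degree w == 1] -> False.
Proof.
move=> a0 xE yE xy Ec /existsP[b /andP[bx /eqP b1]] /existsP[d /andP[dy /eqP d1]].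
have c2 : degree c = 2 by rewrite /degree Ec cards2 xy.
have ac : a != c by apply/eqP => ac; rewrite ac c2 in a0.
have bd : b != d.
  by apply/eqP => bd; move/eqP: xy; apply; apply: (leaf_edge b1) => //; rewrite bd.
have : c \in [set b; d].
  rewrite -(@sep [set a; c] [set b; d]) ?cards2 ?ac ?bd ?inE ?eqxx ?orbT // => z zE.
  rewrite !card_set2I // (negPf (isolated_notin a0 zE)).
  have -> : (c \in z) = (z \in [set x; y]) by rewrite -Ec inE zE.
  have -> : (b \in z) = (z == x).
    by apply/idP/eqP => [h|->//]; apply: (leaf_edge b1).
  have -> : (d \in z) = (z == y).
    by apply/idP/eqP => [h|->//]; apply: (leaf_edge d1).
  by rewrite !inE; have [->|] := eqVneq z x; rewrite ?(negPf xy).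
by rewrite !inE => /orP[]/eqP ce; rewrite ce ?b1 ?d1 in c2.
Qed.

Lemma charge_sum_leaf b m s v : degree v = 1 ->
  \sum_(x in incident v) charge b m s v x = b.
Proof.
move=> v1; rewrite (eq_bigr (fun=> b)) => [|x _]; last by rewrite /charge v1.
by rewrite sum_nat_const -/(degree v) v1 mul1n.
Qed.

Lemma charge_sum_ge b m s v : s <= m -> s <= b ->
  s * degree v <= \sum_(x in incident v) charge b m s v x.
Proof.
move=> sm sb; rewrite mulnC -sum_nat_const; apply: leq_sum => x _.
by rewrite /charge; do 2?[case: ifP].
Qed.

Lemma separating_bound_no_isolated :
  (forall v, degree v != 0) -> 2 * #|V| <= 3 * #|E|.
Proof.
(* Edges weigh 6; every vertex gets at least 4, a leaf at once and any other from two or more shares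
   of at least 2. *)
move=> nis; have := sum_charge (b := 4) (m := 3) (s := 2) erefl edge_has_nonleaf.
have : \sum_(v : V) 4 <= \sum_v \sum_(x in incident v) charge 4 3 2 v x.
  apply: leq_sum => v _; have [v1|v1] := eqVneq (degree v) 1.
    by rewrite charge_sum_leaf.
  by apply: leq_trans (charge_sum_ge _ _ _); rewrite //; have := nis v; lia.
by rewrite sum_nat_const => le eqn; rewrite eqn in le; move: le; set N := #|V|; lia.
Qed.

Lemma separating_bound_isolated a : degree a = 0 -> 3 * #|V| <= 4 * #|E| + 3.
Proof.
(* Edges weigh 4; every vertex except [a] is to get at least 3. *)
move=> a0; have := sum_charge (b := 3) (m := 2) (s := 1) erefl edge_has_nonleaf.
have : \sum_(v in ~: [set a]) 3 <= \sum_v \sum_(x in incident v) charge 3 2 1 v x.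
  rewrite [leqRHS](bigID (mem (~: [set a]))) /=.
  apply: leq_trans (leq_addr _ _); apply: leq_sum => v; rewrite !inE => va.
  (* A second isolated vertex would be a twin of [a]. *)
  have v0 : degree v != 0.
    apply: contra va => /eqP v0; apply/eqP; apply: no_twins => x xE.
    by rewrite (negPf (isolated_notin v0 xE)) (negPf (isolated_notin a0 xE)).
  have [v1|v1] := eqVneq (degree v) 1; first by rewrite charge_sum_leaf.
  have [v2|v2] := eqVneq (degree v) 2; last first.
    by apply: leq_trans (charge_sum_ge _ _ _); rewrite //; lia.
  have /eqP/cards2P[x [y [xy vxy]]] := v2.
  have xv : x \in incident v by rewrite vxy !inE eqxx.
  have yv : y \in incident v by rewrite vxy !inE eqxx orbT.
  rewrite vxy big_setU1 ?inE //= big_set1 /charge (negPf v1).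
  move: xv yv; rewrite !inE => /andP[xE _] /andP[yE _].
  (* At degree 2 only the shares 1 + 1 fall short, and they need a leaf on both edges. *)
  case: ifP => lx; case: ifP => ly //.
  by case: (isolated_no_P3 a0 xE yE xy vxy lx ly).
have := cardsC1 a; rewrite sum_nat_const; lia.
Qed.

Lemma separating_bound : 2 * #|V| <= 3 * #|E|.
Proof.
have [/existsP[a /eqP a0]|] := boolP [exists a, degree a == 0].
  (* 9(|V| - 1) >= 8|V| holds exactly from |V| = 9 on. *)
  by have := separating_bound_isolated a0; lia.
rewrite negb_exists => /forallP; exact: separating_bound_no_isolated.
Qed.

End Discharging.

(** * Distances in the Kneser graph and intersection sizes *)

Section Kneser.
Variable n : nat.
Hypothesis n5 : 5 <= n.
Notation vertex := (kneser_vertex n 2).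
Implicit Types u v x : vertex.

Lemma card_vertex u : #|val u| = 2.
Proof. exact/eqP/(valP u). Qed.

Lemma card_vertexI u v : #|val u :&: val v| <= 2.
Proof. by have := subset_leq_card (subsetIl (val u) (val v)); rewrite card_vertex. Qed.

Definition pair_vertex (a b : 'I_n) (ab : a != b) : vertex :=
  exist _ [set a; b] (introT eqP (etrans (cards2 a b) (congr1 (fun t : bool => t.+1) ab))).

Lemma walk1_kneser u v : walk (@kneser n 2) 1 u v = kneser u v.
Proof.
apply/walkP/idP => [[p []]|uv].
  by case: p => [|w []] //= _; rewrite andbT => uw <-.
by exists [:: v]; rewrite /= uv.
Qed.

(** The union has at most three elements, so [n5] leaves two outside it. *)
Lemma vertex_avoiding u v :
  #|val u :&: val v| != 0 -> exists2 w : vertex, kneser u w & kneser w v.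
Proof.
move=> uv; have : 1 < #|~: (val u :|: val v)|.
  have := cardsC (val u :|: val v); have := cardsUI (val u) (val v).
  by rewrite !card_vertex card_ord; lia.
case/card_gt1P => a [b]; rewrite !inE !negb_or => -[/andP[au av] /andP[bu bv] ab].
exists (pair_vertex ab); rewrite /kneser /= -setI_eq0.
  by rewrite setIC -cards_eq0 card_set2I // (negPf au) (negPf bu).
by rewrite -cards_eq0 card_set2I // (negPf av) (negPf bv).
Qed.

Lemma dist_kneser u v :
  dist (@kneser n 2) u v = nth 0 [:: 1; 2; 0] #|val u :&: val v|.
Proof.
have uvE : (u == v) = (#|val u :&: val v| == 2).
  apply/eqP/eqP => [->|uv]; first by rewrite setIid card_vertex.
  apply: val_inj; have /eqP <- : val u :&: val v == val u.
    by rewrite eqEcard subsetIl uv card_vertex.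
  by apply/eqP; rewrite eqEcard subsetIr uv card_vertex.
have le2 : #|val u :&: val v| <= 2 by exact: card_vertexI.
have := dist_eq0 (@kneser n 2) u v; rewrite uvE.
have w1 : kneser u v = (#|val u :&: val v| == 0) by rewrite cards_eq0 setI_eq0.
have [c0|c0] := eqVneq #|val u :&: val v| 0.
  have /dist_min : walk (@kneser n 2) 1 u v by rewrite walk1_kneser w1 c0.
  by rewrite c0 /=; lia.
have [w uw wv] := vertex_avoiding c0.
have p2 : path (@kneser n 2) u [:: w; v] by rewrite /= uw wv.
have /dist_min d2 : walk (@kneser n 2) 2 u v by apply/walkP; exists [:: w; v].
have cuv : connect (@kneser n 2) u v by apply/connectP; exists [:: w; v].
have d1 : dist (@kneser n 2) u v != 1.
  by apply/eqP => d1; have := dist_walk cuv; rewrite d1 walk1_kneser w1 (negPf c0).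
by case: #|_| c0 le2 => [|[|[|]]] //= _ _; lia.
Qed.

Lemma dist_kneser_eq u v x y :
  (dist (@kneser n 2) u x == dist (@kneser n 2) v y) =
  (#|val u :&: val x| == #|val v :&: val y|).
Proof.
by rewrite !dist_kneser; case: #|_| (card_vertexI u x) => [|[|[|]]] //;
   case: #|_| (card_vertexI v y) => [|[|[|]]].
Qed.

Lemma doubly_resolving_separates (D : {set vertex}) u v :
  doubly_resolving (@kneser n 2) D ->
  (forall x, x \in D -> #|val u :&: val x| = #|val v :&: val x|) -> u = v.
Proof.
move=> /forallP/(_ u)/forallP/(_ v)/implyP rD sD; apply/eqP/negPn/negP => /rD.
case/existsP=> x /andP[xD /existsP[y /andP[yD]]]; rewrite /doubly_resolves.
have /eqP -> : dist (@kneser n 2) u x == dist (@kneser n 2) v x.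
  by rewrite dist_kneser_eq sD.
have /eqP -> : dist (@kneser n 2) u y == dist (@kneser n 2) v y.
  by rewrite dist_kneser_eq sD.
by rewrite eqxx.
Qed.

(* The vertex [o], which both pairs miss, forces the constant difference of the two
   distance vectors to be 0. *)
Lemma separates_doubly_resolving (D : {set vertex}) :
  (forall u v, exists2 o, o \in D & kneser u o && kneser v o) ->
  (forall u v, (forall x, x \in D -> #|val u :&: val x| = #|val v :&: val x|) -> u = v) ->
  doubly_resolving (@kneser n 2) D.
Proof.
move=> miss sep; apply/forallP => u; apply/forallP => v; apply/implyP => uv.
have [o oD /andP[uo vo]] := miss u v.
have [|/existsPn nr] :=
  boolP [exists x in D, dist (@kneser n 2) u x != dist (@kneser n 2) v x].
  case/existsP=> x /andP[xD dx]; apply/existsP; exists x; rewrite xD /=.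
  apply/existsP; exists o; rewrite oD /= /doubly_resolves.
  have /eqP -> : dist (@kneser n 2) u o == dist (@kneser n 2) v o.
    move: uo vo; rewrite dist_kneser_eq /kneser -!setI_eq0 => /eqP-> /eqP->.
    by [].
  by move: dx; lia.
case/eqP: uv; apply: sep => x xD; apply/eqP; rewrite -dist_kneser_eq.
by have := nr x; rewrite xD negbK.
Qed.

(** The discharging bound applies to the image of [D] under the injection [val]. *)
Lemma doubly_resolving_bound (D : {set vertex}) : 9 <= n ->
  doubly_resolving (@kneser n 2) D -> 2 * n <= 3 * #|D|.
Proof.
move=> n9 rD; rewrite -[n in 2 * n]card_ord -(card_imset (mem D) val_inj).
apply: separating_bound; rewrite ?card_ord //.
  by move=> x /imsetP[y _ ->]; exact: card_vertex.
move=> u v /eqP u2 /eqP v2 uv.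
have := @doubly_resolving_separates D (exist _ u u2) (exist _ v v2) rD.
by move=> /(_ _)/(congr1 val); apply => x xD; apply: uv; apply: imset_f.
Qed.

End Kneser.

(** * Upper bound: the star forest *)

Section StarForest.
Variables (n k : nat).
Hypotheses (k_gt0 : 0 < k) (k3n : 3 * k <= n).

(** Centers are the elements below [k]; each [w >= k] is a leaf at its residue mod [k]. *)
Definition star_center (w : 'I_n) : 'I_n :=
  Ordinal (leq_ltn_trans (leq_mod w k) (ltn_ord w)).

Lemma star_center_neq (w : 'I_n) : k <= w -> w != star_center w.
Proof.
move=> kw; apply/eqP => /(congr1 val) /= h.
by have := ltn_pmod w k_gt0; rewrite -h ltnNge kw.
Qed.

Section Separation.
Variables u v : {set 'I_n}.
Hypotheses (u2 : #|u| = 2) (v2 : #|v| = 2).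
Hypothesis uv : forall w : 'I_n, k <= w ->
  (w \in u) + (star_center w \in u) = (w \in v) + (star_center w \in v).

(* If the center i were in u but not in v, two of its leaves would lie in v but not in
   u, so they would be all of v; the star of the second element of u then needs a
   further element of v. *)
Lemma star_center_sub (i : 'I_n) : i < k -> i \in u -> i \in v.
Proof.
move=> ik iu; apply/negPn/negP => iv.
(* As 3k <= n, each center j has the leaves j + k and j + 2k. *)
have leaf (j : 'I_n) m : j < k -> 0 < m < 3 ->
    exists w : 'I_n, [/\ w = j + m * k :> nat, k <= w & star_center w = j].
  move=> jk m3; have wn : j + m * k < n by nia.
  exists (Ordinal wn); split=> //=; first by nia.
  by apply: val_inj; rewrite /= addnC modnMDl modn_small.
have [p [pE kp cp]] := leaf i 1 ik isT; have [q [qE kq cq]] := leaf i 2 ik isT.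
have := uv kp; have := uv kq; rewrite cp cq iu (negPf iv).
case qu: (q \in u); case qv: (q \in v) => // _.
case pu: (p \in u); case pv: (p \in v) => // _.
have pq : p != q by apply/eqP => /(congr1 val) /= h; lia.
have vE : [set p; q] = v.
  by apply/eqP; rewrite eqEcard v2 cards2 pq andbT subUset !sub1set pv qv.
have /card_gt0P[y] : 0 < #|u :\ i| by have := cardsD1 i u; rewrite iu u2; case: #|_|.
rewrite !inE => /andP[yi yu].
have yv : y \in v = false.
  by rewrite -vE !inE; apply/negbTE/negP => /orP[]/eqP ye; rewrite -ye yu in pu qu.
(* A center [y] would force its leaf y + k into [v], a leaf [y] its center; neither is [p] or
   [q]. *)
have [yk|ky] := ltnP y k.
  have [r [rE kr cr]] := leaf y 1 yk isT.
  have := uv kr; rewrite cr yu yv addn1 addn0 -vE !inE.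
  have -> : (r == p) = false.
    apply/eqP => rp; case/eqP: yi; apply: val_inj => /=.
    by move: rE pE; rewrite rp => ->; lia.
  have -> : (r == q) = false.
    by apply/eqP => rq; move: rE qE; rewrite rq => ->; lia.
  by [].
have := uv ky; rewrite yu yv add1n add0n -vE !inE.
have ck : star_center y < k by rewrite /= ltn_pmod.
have -> : (star_center y == p) = false by apply/eqP => yp; rewrite yp ltnNge kp in ck.
by have -> : (star_center y == q) = false by apply/eqP => yq; rewrite yq ltnNge kq in ck.
Qed.

End Separation.

(** By symmetry [u] and [v] contain the same centers; cancelling these leaves the same leaves. *)
Lemma star_separates (u v : {set 'I_n}) : #|u| = 2 -> #|v| = 2 ->
  (forall w : 'I_n, k <= w ->
    (w \in u) + (star_center w \in u) = (w \in v) + (star_center w \in v)) ->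
  u = v.
Proof.
move=> u2 v2 uv.
have ctr (i : 'I_n) : i < k -> (i \in u) = (i \in v).
  move=> ik; apply/idP/idP; first exact: star_center_sub.
  by apply: star_center_sub => // w kw; rewrite uv.
apply/setP => w; have [/ctr//|kw] := ltnP w k.
have := uv w kw; rewrite (ctr (star_center w)) ?ltn_pmod // => /addIn.
by case: (w \in u); case: (w \in v).
Qed.

Lemma leaf_ltn (j : 'I_(n - k)) : k + j < n.
Proof. by have := ltn_ord j; lia. Qed.

Definition star_edge (j : 'I_(n - k)) : kneser_vertex n 2 :=
  pair_vertex (@star_center_neq (Ordinal (leaf_ltn j)) (leq_addr j k)).

Definition star_forest : {set kneser_vertex n 2} := [set star_edge j | j : 'I_(n - k)].

Lemma card_star_forest : #|star_forest| <= n - k.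
Proof. by apply: leq_trans (leq_imset_card _ _) _; rewrite card_ord. Qed.

Lemma star_forest_edge (w : 'I_n) : k <= w ->
  exists2 x, x \in star_forest & val x = [set w; star_center w].
Proof.
move=> kw; have jn : w - k < n - k by have := ltn_ord w; lia.
exists (star_edge (Ordinal jn)); first exact: imset_f.
have we : Ordinal (leaf_ltn (Ordinal jn)) = w by apply: val_inj => /=; lia.
by rewrite /= we.
Qed.

(** The elements of [u] and [v] touch at most four of the [k] stars. *)
Lemma star_forest_misses (u v : kneser_vertex n 2) : 5 <= k ->
  exists2 o, o \in star_forest & kneser u o && kneser v o.
Proof.
move=> k5; pose C := star_center @: (val u :|: val v).
have C4 : #|C| <= 4.
  apply: leq_trans (leq_imset_card _ _) _.
  by apply: leq_trans (leq_card_setU _ _) _; rewrite !card_vertex.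
have kn : k <= n by lia.
have /subsetPn[i /imsetP[j _ ->] iC] : ~~ (widen_ord kn @: [set: 'I_k] \subset C).
  apply/negP => /subset_leq_card; rewrite card_imset ?cardsT ?card_ord; first by lia.
  by move=> a b /(congr1 val)/= ab; apply: val_inj.
have wn : k + j < n by have := ltn_ord j; lia.
have cj : star_center (widen_ord kn j) = widen_ord kn j.
  by apply: val_inj; rewrite /= modn_small.
have cw : star_center (Ordinal wn) = widen_ord kn j.
  by apply: val_inj; rewrite /= modnDl modn_small.
have nuv z : star_center z = widen_ord kn j -> z \notin val u :|: val v.
  by move=> zj; apply: contra iC => zuv; rewrite -zj imset_f.
have [o oD oE] := @star_forest_edge (Ordinal wn) (leq_addr j k).
exists o => //; rewrite /kneser oE cw -!setI_eq0 -!cards_eq0 ![_ :&: [set _; _]]setIC.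
have ne := star_center_neq (w := Ordinal wn) (leq_addr j k); rewrite cw in ne.
rewrite !card_set2I //.
move: (nuv _ cj) (nuv _ cw); rewrite !inE !negb_or.
by move=> /andP[/negPf-> /negPf->] /andP[/negPf-> /negPf->].
Qed.

Lemma star_forest_doubly_resolving : 5 <= k ->
  doubly_resolving (@kneser n 2) star_forest.
Proof.
move=> k5; apply: separates_doubly_resolving => [|u v|u v uv]; first by lia.
  exact: star_forest_misses.
apply: val_inj; apply: star_separates; rewrite ?card_vertex // => w kw.
have [x xD xE] := star_forest_edge kw.
by have := uv x xD; rewrite xE ![_ :&: [set _; _]]setIC !card_set2I ?star_center_neq.
Qed.

End StarForest.

(** * The ceiling and the final count *)

(** The upper hypothesis is m - 1 < 2n/3 with denominators cleared. *)
Lemma ceil_two_thirds (n m : nat) : 2 * n <= 3 * m <= 2 * n + 2 ->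
  Num.ceil (((2 * n)%:R / 3%:R)%R : rat) = m%:Z%R.
Proof.
move=> /andP[h1 h2]; apply: Num.Theory.ceil_def.
have {h1}h1 : ((2 * n)%:R <= (3 * m)%:R :> rat)%R by rewrite Num.Theory.ler_nat.
have {h2}h2 : ((3 * m)%:R <= (2 * n + 2)%:R :> rat)%R by rewrite Num.Theory.ler_nat.
rewrite intrB -pmulrn.
move: h1 h2; rewrite GRing.natrD !GRing.natrM => h1 h2.
by apply/andP; split; lra.
Qed.

Theorem theorem8 (n : nat) (hn : 15 <= n) :
  ((psi (@kneser n 2))%:Z = Num.ceil ((2 * n)%:R / 3%:R : rat))%R.
Proof.
have [[D rD <-] minD] := psiP (@kneser_sym n 2).
have k5 : 5 <= n %/ 3 by lia.
have k0 : 0 < n %/ 3 by lia.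
have k3 : 3 * (n %/ 3) <= n by lia.
have minS := minD _ (star_forest_doubly_resolving k0 k3 k5).
have leS := card_star_forest k0 k3.
have leD : 2 * n <= 3 * #|D| by apply: doubly_resolving_bound rD; lia.
rewrite (@ceil_two_thirds n #|D|) // leD /=.
(* 3(n - n %/ 3) <= 2n + 2, because n %/ 3 loses a remainder of at most 2. *)
by apply: leq_trans (leq_mul (leqnn 3) (leq_trans minS leS)) _; lia.
Qed.
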